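(* Let $T\subset\mathbb{R}^2$ be a triangle and let $\alpha,\beta\in\mathbb{N}_0^3$ be multi-indices such that $\mathcal{I}(\alpha,\beta)<\infty$. (a) For any permutation $\sigma$ of $\{0,1,2\}$ we have $\mathcal{I}(\alpha,\beta)=\mathcal{I}(\sigma(\alpha),\sigma(\beta))$, where $\sigma$ acts on multi-indices by permuting their entries. (b) If $\beta_0,\beta_1,\beta_2\ge1$, then $$\mathcal{I}(\alpha,\beta)=\tfrac12\big(\mathcal{I}(\alpha,\beta-\hat v_0)+\mathcal{I}(\alpha,\beta-\hat v_1)+\mathcal{I}(\alpha,\beta-\hat v_2)\big).$$ (c) If $\beta_0=0$ and $\alpha_0\ge1$, and $\alpha_j+\beta_j<|\alpha|+1$ for some $j\in\{1,2\}$, then for this $j$ $$\mathcal{I}(\alpha,\beta)=\mathcal{I}(\alpha-\hat v_0,\beta-\hat v_{3-j})-\mathcal{I}(\alpha-\hat v_0+\hat v_j,\beta).$$ (d) If $\beta_0=0$, $\beta_1,\beta_2\ge1$ and $\alpha_0>0$, then $$\begin{aligned}\mathcal{I}(\alpha,\beta)&=\tfrac12\big(\mathcal{I}(\alpha,\beta-\hat v_1)+\mathcal{I}(\alpha,\beta-\hat v_2)\big)-\mathcal{I}(\alpha-\hat v_0+\hat v_1+\hat v_2,\beta)\\&\quad+\tfrac12\big(\mathcal{I}(\alpha-\hat v_0+\hat v_1,\beta-\hat v_1)+\mathcal{I}(\alpha-\hat v_0+\hat v_2,\beta-\hat v_2)\big).\end{aligned}$$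
   Context: $T$ has barycentric coordinates $\lambda_0,\lambda_1,\lambda_2$ (with $\lambda_0+\lambda_1+\lambda_2=1$) and area $|T|$. For multi-indices $\alpha=(\alpha_0,\alpha_1,\alpha_2)$ and $\beta=(\beta_0,\beta_1,\beta_2)$, $$\mathcal{I}(\alpha,\beta)=\frac{1}{|T|}\int_T\frac{\lambda_0^{\alpha_0}\lambda_1^{\alpha_1}\lambda_2^{\alpha_2}}{(1-\lambda_0)^{\beta_0}(1-\lambda_1)^{\beta_1}(1-\lambda_2)^{\beta_2}}\,\mathrm{d}x\in[0,\infty].$$ The same formula is used if an entry of $\beta$ equals $-1$ (this can occur only in (c)). Further, $|\alpha|=\alpha_0+\alpha_1+\alpha_2$ and $\hat v_0=(1,0,0)$, $\hat v_1=(0,1,0)$, $\hat v_2=(0,0,1)$. *)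

(* Defs.v *)
From HB Require Import structures.
From mathcomp Require Import all_boot all_order all_algebra all_fingroup.
From mathcomp Require Import all_classical all_reals all_analysis.

Set Implicit Arguments.
Unset Strict Implicit.
Unset Printing Implicit Defensive.

Import Order.TTheory GRing.Theory Num.Theory.
Import numFieldNormedType.Exports.

Local Open Scope classical_set_scope.
Local Open Scope ring_scope.

(* Exponents live in int rather than nat so that beta - vhat i may have an
   entry -1; elements of N_0^3 are singled out by [nonneg_mi]. *)
Definition multiindex := {ffun 'I_3 -> int}.

Definition nonneg_mi (a : multiindex) : Prop := forall i, 0 <= a i.

Definition mi_size (a : multiindex) : int := \sum_i a i.

Definition vhat (i : 'I_3) : multiindex := [ffun k => (k == i)%:Z].

Definition mi_perm (s : 'S_3) (a : multiindex) : multiindex :=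
  [ffun i => a (s i)].

Section Triangle.
Context {R : realType}.
Implicit Types (v : 'I_3 -> R * R) (x : R * R) (l : 'rV[R]_3).

Local Notation area := (@lebesgue_measure R \x @lebesgue_measure R)%E.

Definition homog x : 'rV[R]_3 := \row_(k < 3) [tuple 1; x.1; x.2]`_k.

Definition vertex_mx v : 'M[R]_3 := \matrix_(i < 3) homog (v i).

(* Linear independence of the rows (1, v_i) is affine independence of the v_i,
   i.e. the v_i are the vertices of a nondegenerate triangle. *)
Definition affinely_independent v : bool := row_free (vertex_mx v).

Definition triangle v : set (R * R) :=
  [set x | exists l : 'I_3 -> R,
    [/\ forall i, 0 <= l i, \sum_i l i = 1,
        x.1 = \sum_i l i * (v i).1 & x.2 = \sum_i l i * (v i).2]].

(* The solution l of l *m vertex_mx v = (1, x.1, x.2), see [baryP]. *)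
Definition bary v (i : 'I_3) x : R := (homog x *m invmx (vertex_mx v)) 0 i.

Lemma homog_combE v x l :
  (l *m vertex_mx v = homog x) <->
  [/\ \sum_i l 0 i = 1, \sum_i l 0 i * (v i).1 = x.1
    & \sum_i l 0 i * (v i).2 = x.2].
Proof.
split=> [lx|[s1 sx sy]].
  by split; [move/rowP: lx => /(_ 0) | move/rowP: lx => /(_ 1)
            | move/rowP: lx => /(_ 2)]; rewrite !mxE /= => <-;
     apply: eq_bigr => i _; rewrite !mxE //= mulr1.
apply/rowP => k; rewrite !mxE.
case: k => [[|[|[|//]]] ?] /=; rewrite -?s1 -?sx -?sy;
  by apply: eq_bigr => i _; rewrite !mxE //= mulr1.
Qed.

Lemma baryP v x (l : 'I_3 -> R) : affinely_independent v ->
  [/\ \sum_i l i = 1, \sum_i l i * (v i).1 = x.1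
    & \sum_i l i * (v i).2 = x.2] <-> forall i, l i = bary v i x.
Proof.
rewrite /affinely_independent row_free_unit => vU.
have lE : forall i, (\row_i l i) 0 i = l i by move=> i; rewrite mxE.
have e1 : \sum_i l i = \sum_i (\row_i l i) 0 i.
  by apply: eq_bigr => i _; rewrite lE.
have e2 : \sum_i l i * (v i).1 = \sum_i (\row_i l i) 0 i * (v i).1.
  by apply: eq_bigr => i _; rewrite lE.
have e3 : \sum_i l i * (v i).2 = \sum_i (\row_i l i) 0 i * (v i).2.
  by apply: eq_bigr => i _; rewrite lE.
rewrite e1 e2 e3 -homog_combE; split=> [lx i|lb].
  by rewrite /bary -lx mulmxK // lE.
have -> : \row_i l i = homog x *m invmx (vertex_mx v).
  by apply/rowP => i; rewrite lE lb.
by rewrite mulmxKV.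
Qed.

Lemma triangleE v : affinely_independent v ->
  triangle v = [set x | forall i, 0 <= bary v i x].
Proof.
move=> vI; apply/seteqP; split=> x /=.
  move=> [l [l0 l1 lx ly]] i.
  by have /(baryP _ _ vI) <- : [/\ \sum_i l i = 1, \sum_i l i * (v i).1 = x.1
    & \sum_i l i * (v i).2 = x.2].
move=> b0; exists (fun i => bary v i x).
by have /(_ (fun=> erefl)) [? ? ?] :=
  (baryP x (fun i => bary v i x) vI).2.
Qed.

(* Where a denominator vanishes (only at a vertex of the triangle, a null set)
   the integrand takes a junk value. *)
Definition Iint v (a b : multiindex) : \bar R :=
  ((area (triangle v))^-1 *
   \int[area]_(x in triangle v)
     ((\prod_i bary v i x ^ a i) / (\prod_i (1 - bary v i x) ^ b i))%:E)%E.

End Triangle.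

Arguments vhat i%_R.
Arguments Iint {R} v a%_R b%_R.

(* Main.v *)
(** Affine maps scale Lebesgue measure, so I(alpha, beta) is the mean over one
    fixed triangle of a function of the barycentric coordinates l0, l1, l2: this
    gives (a).  Away from the vertices, which form a null set, (b), (c) and (d)
    are pointwise consequences of l0 + l1 + l2 = 1; in (c) and (d) a term is
    moved to the other side, so its mean has to be finite.  Near the vertex i
    the integrand is comparable to (1 - l_i) ^ m_i with
    m_i = |alpha| - alpha_i - beta_i, so finiteness is decided by the three
    exponents m_i, and these are preserved or remain at least -1 when alpha is
    replaced by the exponent of the moved term. *)
Require Import Defs.
From HB Require Import structures.
From mathcomp Require Import all_boot all_order all_algebra all_fingroup.
From mathcomp Require Import all_classical all_reals all_analysis.
From mathcomp Require Import measurable_realfun ring lra zify.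

Set Implicit Arguments.
Unset Strict Implicit.
Unset Printing Implicit Defensive.

Import Order.TTheory GRing.Theory Num.Theory.
Import numFieldNormedType.Exports.

Local Open Scope ring_scope.

(** The change of variables is done without determinants. For an affine bijection phi, Fubini and
    the invariance of the area under reflections show that the integrals of f(phi) and of f have the
    same ratio for every f >= 0. With the indicator of the standard triangle as a test function this
    ratio becomes a quotient of two areas, so it disappears from means.

    A mean can therefore be computed on whichever triangle is convenient: the same triangle with
    relabelled vertices for (a); a subtriangle with one vertex in common for lower bounds; the
    triangle (0,0), (1,0), (1,1), on which 1 - l_0 is the abscissa, to integrate its inverse.

    The comparison with (1 - l_i)^m_i is one-sided on the whole triangle: the numerator may vanish
    on the edges that meet at vertex i, so the lower bound holds only on a sector away from them.

    The identities are first proved as equalities between sums in [0, +oo]; subtraction appears only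
    once the moved term is known to be finite. *)

Section PlaneLebesgue.
Context {R : realType}.
Local Open Scope classical_set_scope.
Local Open Scope ereal_scope.

Local Notation line := (measurableTypeR R).
Local Notation plane := (line * line)%type.

(** * Lebesgue measure on the plane *)

Definition lebesgue1 : {sigma_finite_measure set line -> \bar R} :=
  lebesgue_measure.

Definition area : set plane -> \bar R := lebesgue1 \x lebesgue1.

HB.instance Definition _ := Measure.copy area (lebesgue1 \x lebesgue1).

Lemma areaX (A B : set line) : measurable A -> measurable B ->
  area (A `*` B) = lebesgue1 A * lebesgue1 B.
Proof. exact: product_measure1E. Qed.

(** Fubini is applied below on [plane * plane], with two copies of [area]. Squares of an increasing
    exhaustion of the line exhaust the plane. *)
Lemma area_sigma_finite : sigma_finite setT area.
Proof.
have /sigma_finiteP[F [TF ndF Foo]] := @sigma_finiteT _ _ _ lebesgue1.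
exists (fun n => F n `*` F n).
  rewrite -setXTT {1 2}TF predeqE => -[x y]; split.
    move=> [/= [n _ Fnx] [k _ Fky]]; exists (maxn n k) => //; split.
    - by move: x Fnx; exact/subsetPset/ndF/leq_maxl.
    - by move: y Fky; exact/subsetPset/ndF/leq_maxr.
  by move=> [n _ []/= ? ?]; split; exists n.
move=> k; have [mF oF] := Foo k; split; first exact: measurableX.
by rewrite areaX// lte_mul_pinfty// ge0_fin_numE.
Qed.

HB.instance Definition _ :=
  Measure_isSigmaFinite.Build _ _ _ area area_sigma_finite.

(** * Invariance under reflections and translations *)

Lemma measurable_reflect1 (c : R) :
  measurable_fun [set: line] (fun x : line => (c - x)%R : line).
Proof. exact: measurable_funB. Qed.

(** Lebesgue measure is determined by its values on the intervals []a, b]]; a reflection turns such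
    an interval into one closed on the other side, of the same length. *)
Lemma lebesgue_measure_reflect (c : R) (A : set line) : measurable A ->
  pushforward lebesgue1 (fun x : line => (c - x)%R : line) A = lebesgue1 A.
Proof.
move=> mA; have mr := measurable_reflect1 c.
apply/esym/lebesgue_measure_unique => //= _ [[a b]] _ <-.
rewrite /pushforward.
have ineq (x : R) : ((a < c - x <= b) = (c - b <= x < c - a))%R.
  by apply/idP/idP => /andP[? ?]; apply/andP; split; lra.
have -> : (fun x : line => (c - x)%R : line) @^-1` `]a, b]
        = `[(c - b)%R, (c - a)%R[.
  by apply/seteqP; split=> x /=; rewrite !in_itv /= ineq.
rewrite !lebesgue_measure_itv /= !lte_fin ltrD2l ltrN2 -!EFinB.
by congr (if _ then _%:E else _); lra.
Qed.

Lemma measurable_reflect (c : plane) :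
  measurable_fun [set: plane] (fun x : plane => (c - x)%R : plane).
Proof.
rewrite (_ : (fun x => _) = fun x : plane =>
    ((c.1 - x.1)%R : line, (c.2 - x.2)%R : line)) //.
apply: measurable_fun_pair.
  exact: (measurableT_comp (measurable_reflect1 c.1) measurable_fst).
exact: (measurableT_comp (measurable_reflect1 c.2) measurable_snd).
Qed.

Lemma area_reflect (c : plane) (A : set plane) : measurable A ->
  area A = pushforward area (fun x : plane => (c - x)%R : plane) A.
Proof.
move=> mA; have mr := measurable_reflect c.
apply: (product_measure_unique (m1 := lebesgue1) (m2 := lebesgue1)) => //=.
move=> B C mB mC; rewrite /pushforward.
rewrite (_ : _ @^-1` _ = (fun x : line => (c.1 - x)%R : line) @^-1` B `*`
   (fun x : line => (c.2 - x)%R : line) @^-1` C); last by [].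
rewrite areaX; first by congr (_ * _); exact: lebesgue_measure_reflect.
  by rewrite -[X in measurable X]setTI; exact: measurable_reflect1.
by rewrite -[X in measurable X]setTI; exact: measurable_reflect1.
Qed.

Lemma ge0_integral_reflect (c : plane) (f : plane -> \bar R) :
  measurable_fun setT f -> (forall x, 0 <= f x) ->
  \int[area]_x f (c - x)%R = \int[area]_x f x.
Proof.
move=> mf f0; have mr := measurable_reflect c.
transitivity
    (\int[pushforward area (fun x : plane => (c - x)%R : plane)]_x f x).
  by rewrite ge0_integral_pushforward.
by apply: eq_measure_integral => A mA _; exact/esym/area_reflect.
Qed.


Lemma ge0_integral_translate (c : plane) (f : plane -> \bar R) :
  measurable_fun setT f -> (forall x, 0 <= f x) ->
  \int[area]_x f (x - c)%R = \int[area]_x f x.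
Proof.
move=> mf f0.
(* A translation is a composite of two reflections: x - c = 0 - (c - x). *)
pose g (x : plane) := f (0 - x)%R.
transitivity (\int[area]_x g (c - x)%R).
  by apply: eq_integral => x _; rewrite /g sub0r opprB.
rewrite ge0_integral_reflect //; first exact: ge0_integral_reflect.
  exact: measurableT_comp mf (measurable_reflect 0%R).
by move=> x; exact: f0.
Qed.

(** * Affine change of variables by Fubini *)

Section AffineChange.
Variable phi : plane -> plane.
Hypothesis mphi : measurable_fun setT phi.

Lemma measurable_shear : measurable_fun [set: plane * plane]
  (fun z : plane * plane => (z.2 - phi z.1)%R : plane).
Proof.
have m1 := measurableT_comp mphi (@measurable_fst _ _ plane plane).
have m2 := @measurable_snd _ _ plane plane.
apply: measurable_fun_pair.
  exact: (measurable_funB (measurableT_comp measurable_fst m2)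
                          (measurableT_comp measurable_fst m1)).
exact: (measurable_funB (measurableT_comp measurable_snd m2)
                        (measurableT_comp measurable_snd m1)).
Qed.

Lemma measurable_convolution (f g : plane -> \bar R) :
  measurable_fun setT f -> measurable_fun setT g ->
  measurable_fun setT
    (fun z : plane * plane => f (phi z.1) * g (z.2 - phi z.1)%R).
Proof.
move=> mf mg; apply: emeasurable_funM.
  exact: measurableT_comp mf (measurableT_comp mphi measurable_fst).
exact: measurableT_comp mg measurable_shear.
Qed.

(** The inner integral is that of a translate of g, hence does not depend on x. *)
Lemma integral_convolution (f g : plane -> \bar R) :
  measurable_fun setT f -> measurable_fun setT g ->
  (forall x, 0 <= f x) -> (forall x, 0 <= g x) ->
  \int[area]_x \int[area]_y (f (phi x) * g (y - phi x)%R)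
  = (\int[area]_x f (phi x)) * \int[area]_x g x.
Proof.
move=> mf mg f0 g0.
transitivity (\int[area]_x (f (phi x) * \int[area]_y g y)).
  apply: eq_integral => x _; rewrite ge0_integralZl //.
    by congr (_ * _); exact: ge0_integral_translate.
  apply: (measurableT_comp mg) => //.
  exact: (measurableT_comp measurable_shear (pair1_measurable x)).
rewrite ge0_integralZr //; last by apply: integral_ge0.
exact: measurableT_comp mf mphi.
Qed.

(* The first hypothesis holds for affine bijections.  The two sides are the
   double integral of f (phi x) * g (y - phi x), integrated first in y or first
   in x; translation and reflection invariance of [area] suffice. *)
Lemma integral_affine_change (f g : plane -> \bar R) :
  (forall y, exists w, forall x, phi (w - x)%R = (y - phi x)%R) ->
  measurable_fun setT f -> measurable_fun setT g ->
  (forall x, 0 <= f x) -> (forall x, 0 <= g x) ->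
  (\int[area]_x f (phi x)) * \int[area]_x g x
  = (\int[area]_x g (phi x)) * \int[area]_x f x.
Proof.
move=> hphi mf mg f0 g0.
rewrite -integral_convolution // -[RHS]integral_convolution //.
rewrite (fubini_tonelli (fun z : plane * plane =>
  f (phi z.1) * g (z.2 - phi z.1)%R)); first last.
- by move=> z; exact: mule_ge0.
- exact: measurable_convolution.
rewrite [RHS](fubini_tonelli (fun z : plane * plane =>
  g (phi z.1) * f (z.2 - phi z.1)%R)); first last.
- by move=> z; exact: mule_ge0.
- exact: measurable_convolution.
(* For fixed y, replacing x by w - x exchanges [phi x] and [y - phi x], which exchanges the roles of
   f and g. *)
apply: eq_integral => y _; have [w hw] := hphi y.
rewrite -(ge0_integral_reflect w) /=; first last.
- by move=> x; exact: mule_ge0.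
- exact: (measurableT_comp (measurable_convolution mf mg) (pair2_measurable y)).
by apply: eq_integral => x _; rewrite hw subKr muleC.
Qed.

End AffineChange.


(** * The standard triangle (0,0), (1,0), (0,1), with its barycentric coordinates in closed form *)

Definition coords (p : plane) (i : 'I_3) : R :=
  [tuple (1 - p.1 - p.2)%R; p.1 : R; p.2 : R]`_i.

Definition standard_triangle : set plane :=
  [set p | forall i, (0 <= coords p i)%R].

Lemma sum_coords (p : plane) : (\sum_i coords p i = 1)%R.
Proof. by rewrite !big_ord_recl big_ord0 /coords /=; lra. Qed.

Lemma measurable_coords i : measurable_fun [set: plane] (coords ^~ i).
Proof.
have m1 : @measurable_fun _ _ plane R [set: plane] (fun p : plane => p.1 : R)
    := measurable_fst.
have m2 : @measurable_fun _ _ plane R [set: plane] (fun p : plane => p.2 : R)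
    := measurable_snd.
case: i => [[|[|[|//]]] ?] //.
by apply: measurable_funB => //; apply: measurable_funB.
Qed.

Lemma measurable_standard_triangle : measurable standard_triangle.
Proof.
rewrite (_ : standard_triangle =
    \bigcap_(i in [set: 'I_3]) [set p | 0 <= coords p i]%R).
  apply: fin_bigcap_measurable => // i _.
  rewrite (_ : mkset _ = setT `&` coords ^~ i @^-1` `[0%R, +oo[).
    by apply: measurable_coords => //; exact: measurable_itv.
  by rewrite setTI; apply/seteqP; split=> p /=; rewrite in_itv /= andbT.
by apply/seteqP; split=> p h i; [move=> _; exact: h|exact: (h i)].
Qed.

Lemma standard_triangle_le1 (p : plane) i :
  standard_triangle p -> (coords p i <= 1)%R.
Proof.
move=> hp; rewrite -(sum_coords p) (bigD1 i) //= lerDl.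
by apply: sumr_ge0 => k _; exact: hp.
Qed.

Lemma area_standard_triangle_gt0 : 0 < area standard_triangle.
Proof.
apply: (@lt_le_trans _ _ (area (`[0%R, 2^-1%R] `*` `[0%R, 2^-1%R]))).
  rewrite areaX //= !lebesgue_measure_itv /= !lte_fin invr_gt0 ltr0n.
  by rewrite -!EFinB -EFinM lte_fin subr0 mulr_gt0 ?invr_gt0.
apply: le_measure; rewrite ?inE; first exact: measurableX.
  exact: measurable_standard_triangle.
move=> p [] /=; rewrite !in_itv /= => /andP[? ?] /andP[? ?].
by case=> [[|[|[|//]]] ?] //; rewrite /coords /=; lra.
Qed.

Lemma area_box_lty (A : set plane) (M : R) : measurable A ->
  (forall p, A p -> (`|p.1| <= M /\ `|p.2| <= M)%R) -> area A < +oo.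
Proof.
move=> mA hA.
apply: (@le_lt_trans _ _ (area (`[(- M)%R, M] `*` `[(- M)%R, M]))).
  apply: le_measure; rewrite ?inE //; first exact: measurableX.
  by move=> p /hA [] /=; rewrite !in_itv /= !ler_norml.
rewrite areaX //= !lebesgue_measure_itv /=.
by case: ifP => _; rewrite ?mule0 // -EFinB -EFinM ltry.
Qed.

Lemma area_standard_triangle_lty : area standard_triangle < +oo.
Proof.
apply: (@area_box_lty _ 1%R); first exact: measurable_standard_triangle.
move=> p hp; have h := fun i => standard_triangle_le1 i hp.
split; rewrite ger0_norm;
  [exact: (h 1%R)|exact: (hp 1%R)|exact: (h 2%R)|exact: (hp 2%R)].
Qed.

Variable v : 'I_3 -> R * R.

(** The affine bijection that takes each vertex of v to the standard vertex of the same index; it is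
    the [phi] of [integral_affine_change]. *)
Definition bary_pair (x : plane) : plane := (bary v 1%R x, bary v 2%R x).

Hypothesis hv : affinely_independent v.

Lemma coords_bary_pair x i : coords (bary_pair x) i = bary v i x.
Proof.
have [h _ _] := (baryP x (fun i => bary v i x) hv).2 (fun=> erefl).
move: h; rewrite !big_ord_recl big_ord0 /= => h.
case: i => [[|[|[|//]]] ?]; rewrite /coords /=.
- rewrite (_ : Ordinal _ = ord0); last exact: val_inj.
  move: h; rewrite (_ : lift ord0 ord0 = 1%R); last exact: val_inj.
  rewrite (_ : lift ord0 (lift ord0 ord0) = 2%R); last exact: val_inj.
  lra.
- by congr (bary v _ x); exact: val_inj.
- by congr (bary v _ x); exact: val_inj.
Qed.

Lemma triangle_preimage :
  triangle v = bary_pair @^-1` standard_triangle.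
Proof.
rewrite triangleE //; apply/seteqP; split=> x h i /=.
  by rewrite coords_bary_pair; exact: h.
by move: (h i); rewrite coords_bary_pair.
Qed.

(** Barycentric coordinates are affine, not linear: they respect x - y + z because its coefficients
    sum to 1. *)
Lemma bary_affine (x y z : plane) i :
  bary v i (x - y + z)%R = (bary v i x - bary v i y + bary v i z)%R.
Proof.
rewrite /bary !mxE !big_ord_recl !big_ord0 !mxE /=; lra.
Qed.

Lemma bary_pair_surj (q : plane) : exists x, bary_pair x = q.
Proof.
exists (\sum_i coords q i * (v i).1, \sum_i coords q i * (v i).2)%R.
set x := (X in bary_pair X).
have h i : coords q i = bary v i x.
  by apply: (baryP x (coords q) hv).1; split => //; exact: sum_coords.
by rewrite /bary_pair -!h; case: q {h x}.
Qed.

Lemma bary_pair_reflect (y : plane) :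
  exists w, forall x, bary_pair (w - x)%R = (y - bary_pair x)%R.
Proof.
(* Subtracting [bary_pair 0] compensates the constant term of the affine map, since w - x is treated
   as w - x + 0. *)
have [w hw] := bary_pair_surj (y - bary_pair 0)%R.
exists w => x; rewrite /bary_pair -[(w - x)%R]addr0 !bary_affine.
move: hw => [h1 h2].
by congr pair; rewrite /= ?h1 ?h2 /=; lra.
Qed.

Lemma measurable_bary i : measurable_fun [set: plane] (bary v i).
Proof.
rewrite (_ : bary v i = fun x => (invmx (vertex_mx v) 0 i +
   (x.1 * invmx (vertex_mx v) 1 i + x.2 * invmx (vertex_mx v) 2 i))%R).
  have m1 : @measurable_fun _ _ plane R [set: plane] (fun p : plane => p.1 : R)
    := measurable_fst.
  have m2 : @measurable_fun _ _ plane R [set: plane] (fun p : plane => p.2 : R)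
    := measurable_snd.
  apply: measurable_funD; first exact: measurable_cst.
  by apply: measurable_funD; apply: measurable_funM.
apply/funext => x; rewrite /bary !mxE !big_ord_recl big_ord0 !mxE /=.
rewrite mul1r addr0.
by congr (invmx _ _ i + (_ * invmx _ _ i + _ * invmx _ _ i))%R; exact: val_inj.
Qed.

Lemma measurable_bary_pair : measurable_fun [set: plane] bary_pair.
Proof. apply: measurable_fun_pair; exact: measurable_bary. Qed.

Lemma measurable_triangle : measurable (triangle v : set plane).
Proof.
rewrite triangle_preimage -[X in measurable X]setTI.
by apply: measurable_bary_pair => //; exact: measurable_standard_triangle.
Qed.

Lemma area_triangle_lty : area (triangle v) < +oo.
Proof.
pose M := (\sum_i (`|(v i).1| + `|(v i).2|))%R.
apply: (@area_box_lty _ M); first exact: measurable_triangle.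
move=> x [l [l0 l1 -> ->]].
have le1 i : (l i <= 1)%R.
  by rewrite -l1 (bigD1 i) //= lerDl; apply: sumr_ge0 => k _; exact: l0.
split; apply: (le_trans (ler_norm_sum _ _ _)); apply: ler_sum => i _;
  rewrite normrM (ger0_norm (l0 i)).
  by apply: (le_trans (ler_piMl _ (le1 i))) => //; rewrite lerDl.
by apply: (le_trans (ler_piMl _ (le1 i))) => //; rewrite lerDr.
Qed.

Lemma area_setT : area [set: plane] = +oo.
Proof.
rewrite -setXTT areaX // -set_itvNyy /= lebesgue_measure_itv /=.
by rewrite mulyy.
Qed.

Lemma integral_indic_bary_pair :
  \int[area]_x (EFin \o \1_standard_triangle) (bary_pair x)
  = area (triangle v).
Proof.
rewrite -(setIT (triangle v)) -integral_indic //; last first.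
  exact: measurable_triangle.
by apply: eq_integral => x _ /=; rewrite !indicE triangle_preimage.
Qed.

(** In [integral_affine_change], G is cut off outside the standard triangle and the second function
    is the indicator of that triangle. The two areas that arise take the place of the Jacobian. *)
Lemma integral_triangle (G : plane -> \bar R) :
  measurable_fun setT G -> (forall p, standard_triangle p -> 0 <= G p) ->
  (\int[area]_(x in triangle v) G (bary_pair x)) * area standard_triangle
  = area (triangle v) * \int[area]_(p in standard_triangle) G p.
Proof.
move=> mG G0; have mT := measurable_standard_triangle.
have mi : measurable_fun setT (EFin \o (\1_standard_triangle : plane -> R)).
  exact/measurable_EFinP/measurable_indic.
have mGT : measurable_fun setT (G \_ standard_triangle).
  by apply/(measurable_restrictT G mT); exact: measurable_funTS.
have e : (fun x => G (bary_pair x)) \_ (triangle v)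
     = (G \_ standard_triangle) \o bary_pair.
  by apply/funext => x; rewrite /= !patchE triangle_preimage.
rewrite [\int[area]_(x in triangle v) _]integral_mkcond e.
rewrite [\int[area]_(p in standard_triangle) _]integral_mkcond.
have := integral_affine_change measurable_bary_pair bary_pair_reflect mGT mi.
rewrite integral_indic_bary_pair integral_indic // setIT; apply => p.
  by rewrite patchE; case: ifPn => // /[!inE]; exact: G0.
by rewrite lee_fin indicE.
Qed.

(** With the constant 1 as second function, a null triangle would give 0 * +oo = +oo *
    [area standard_triangle], where the left side is 0 by convention and the right side is +oo. *)
Lemma area_triangle_gt0 : 0 < area (triangle v).
Proof.
rewrite lt0e measure_ge0 andbT; apply/eqP => T0.
have mT := measurable_standard_triangle.
have mi : measurable_fun setT (EFin \o (\1_standard_triangle : plane -> R)).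
  exact/measurable_EFinP/measurable_indic.
have := integral_affine_change measurable_bary_pair bary_pair_reflect mi
  (measurable_cst 1).
rewrite integral_indic_bary_pair integral_indic // setIT.
rewrite !integral_cst // !mul1e.
rewrite T0 mul0e => /(_ _ _)/esym/eqP; rewrite mule_eq0.
rewrite [X in _ || X]gt_eqF ?area_standard_triangle_gt0 // orbF => h.
suff : area [set: plane] == 0 by rewrite area_setT.
by apply: h => p; rewrite lee_fin.
Qed.

Definition standard_mean (G : plane -> \bar R) : \bar R :=
  (area standard_triangle)^-1 * \int[area]_(p in standard_triangle) G p.

Lemma triangle_mean (G : plane -> \bar R) :
  measurable_fun setT G -> (forall p, standard_triangle p -> 0 <= G p) ->
  (area (triangle v))^-1 * \int[area]_(x in triangle v) G (bary_pair x)
  = standard_mean G.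
Proof.
move=> mG G0; have := integral_triangle mG G0; rewrite /standard_mean.
have T0 := area_triangle_gt0; have To := area_triangle_lty.
have S0 := area_standard_triangle_gt0; have So := area_standard_triangle_lty.
set I := (X in X * _ = _); set J := \int[area]_(p in standard_triangle) _.
move: T0 To S0 So.
case: (area (triangle v)) => [t||] //.
case: (area standard_triangle) => [s||] //.
rewrite !lte_fin => t0 _ s0 _ e.
rewrite !inver (gt_eqF t0) (gt_eqF s0).
have : t^-1%:E * (s^-1)%:E * (I * s%:E) = t^-1%:E * (s^-1)%:E * (t%:E * J).
  by rewrite e.
rewrite (muleC I) !muleA -!EFinM mulfVK ?gt_eqF // mulrC mulrA mulfV ?gt_eqF //.
by rewrite mul1r.
Qed.

End PlaneLebesgue.

(** * The integrand on the standard triangle, and part (a) *)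

Section Integrand.
Context {R : realType}.
Local Open Scope classical_set_scope.

Local Notation line := (measurableTypeR R).
Local Notation plane := (line * line)%type.
Local Notation area := (@area R).
Local Notation coords := (@coords R).
Local Notation standard_triangle := (@standard_triangle R).


(** Inversion is continuous on the open set of nonzero reals, and on {0} it is constant because the
    inverse of 0 is 0 by convention. *)
Lemma measurable_funV d (T : measurableType d) (f : T -> R) :
  measurable_fun [set: T] f -> measurable_fun [set: T] (fun x => (f x)^-1).
Proof.
move=> mf; suff m : measurable_fun [set: R] (@GRing.inv R).
  exact: measurableT_comp m mf.
rewrite -(setvU [set 0%R]); apply/measurable_funU => //.
  exact: measurableC.
split; last first.
  apply: (@eq_measurable_fun _ _ R R [set 0%R] (fun=> 0%R : R)).
    by move=> x /[!inE] ->; rewrite invr0.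
  exact: measurable_cst.
apply: open_continuous_measurable_fun.
  rewrite openC; exact: closed_eq.
by move=> x /[!inE] /eqP x0; exact: inv_continuous.
Qed.

Lemma measurable_fun_exprz d (T : measurableType d) (f : T -> R) (n : int) :
  measurable_fun [set: T] f -> measurable_fun [set: T] (fun x => f x ^ n).
Proof.
move=> mf; case: n => n; first exact: measurable_funX.
by apply: measurable_funV; exact: measurable_funX.
Qed.

Definition integrand (a b : multiindex) (p : plane) : R :=
  (\prod_i coords p i ^ a i) / (\prod_i (1 - coords p i) ^ b i).

Local Arguments integrand (a b)%_R p.

Lemma measurable_integrand a b : measurable_fun setT (integrand a b).
Proof.
apply: measurable_funM; last apply: measurable_funV.
  apply: measurable_prod => i _; apply: measurable_fun_exprz.
  exact: measurable_coords.
apply: measurable_prod => i _; apply: measurable_fun_exprz.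
by apply: measurable_funB => //; exact: measurable_coords.
Qed.

Lemma integrand_ge0 a b p : standard_triangle p -> 0 <= integrand a b p.
Proof.
move=> hp; apply: divr_ge0; apply: prodr_ge0 => i _; apply: exprz_ge0.
  exact: hp.
by rewrite subr_ge0; exact: standard_triangle_le1.
Qed.

Lemma Iint_mean v a b : affinely_independent v ->
  Iint v a b = standard_mean (EFin \o integrand a b).
Proof.
move=> hv; rewrite -(triangle_mean hv); first last.
- by move=> p hp; rewrite lee_fin; exact: integrand_ge0.
- by apply/measurable_EFinP; exact: measurable_integrand.
congr (_ * _)%E; apply: eq_integral => x _ /=; rewrite /integrand.
congr ((_ / _)%:E); apply: eq_bigr => i _; rewrite coords_bary_pair //.
Qed.

Lemma vertex_mx_perm v (s : 'S_3) :
  vertex_mx (v \o s) = row_perm s (@vertex_mx R v).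
Proof. by apply/matrixP => i j; rewrite !mxE. Qed.

Lemma affinely_independent_perm v (s : 'S_3) :
  affinely_independent v -> affinely_independent (v \o s : 'I_3 -> R * R).
Proof.
rewrite /affinely_independent vertex_mx_perm row_permE !row_free_unit => vU.
by rewrite unitmx_mul unitmx_perm.
Qed.

Lemma bary_perm v (s : 'S_3) x i : affinely_independent v ->
  bary (v \o s : 'I_3 -> R * R) i x = bary v (s i) x.
Proof.
move=> hv.
have [h1 h2 h3] := (baryP x (fun i => bary v i x) hv).2 (fun=> erefl).
apply/esym; move: i; apply/(baryP x (fun i => bary v (s i) x)).
  exact: affinely_independent_perm.
split; [rewrite -h1|rewrite -h2|rewrite -h3];
  by rewrite [RHS](reindex_inj (@perm_inj _ s)).
Qed.

Lemma triangle_perm v (s : 'S_3) : affinely_independent v ->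
  triangle (v \o s) = triangle v :> set (R * R).
Proof.
move=> hv; rewrite !triangleE //; last exact: affinely_independent_perm.
apply/seteqP; split=> x h i; last by rewrite bary_perm.
by have := h ((s^-1)%g i); rewrite bary_perm // permKV.
Qed.

(** Relabelling the vertices by s^-1 keeps the set and, by [Iint_mean], the value at a and b, while
    it permutes the coordinates in the integrand. *)
Lemma Iint_perm v a b (s : 'S_3) : affinely_independent v ->
  Iint v (mi_perm s a) (mi_perm s b) = @Iint R v a b.
Proof.
move=> hv; have hvs := affinely_independent_perm (s^-1)%g hv.
rewrite [RHS](Iint_mean a b hv) -(Iint_mean a b hvs) /Iint triangle_perm //.
congr (_ * _)%E; apply: eq_integral => x _; congr ((_ / _)%:E).
  rewrite [RHS](reindex_inj (@perm_inj _ s)); apply: eq_bigr => i _.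
  by rewrite bary_perm // permK ffunE.
rewrite [RHS](reindex_inj (@perm_inj _ s)); apply: eq_bigr => i _.
by rewrite bary_perm // permK ffunE.
Qed.

Local Notation mean := (@standard_mean R).

(** * Calculus of means up to the vertices *)

(** A coordinate equal to 1 forces the other two to vanish. Away from these three points the factors
    [1 - coords p i] are positive and can be cancelled. *)
Lemma negligible_vertices :
  area.-negligible [set p | standard_triangle p /\ exists i, 1 <= coords p i].
Proof.
have pt (x y : R) : area.-negligible [set ((x, y) : plane)].
  apply/negligibleP.
    rewrite (_ : [set _] = [set x] `*` [set y]); first exact: measurableX.
    by apply/seteqP; split=> [p /= ->//|[p q] /= [-> ->]].
  rewrite (_ : [set _] = [set x] `*` [set y]).
    apply: (etrans (areaX _ _)) => //.
    by rewrite /= lebesgue_measure_set1 mul0e.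
  by apply/seteqP; split=> [p /= ->//|[p q] /= [-> ->]].
apply: (@negligibleS _ _ _ _
  ([set (0, 0) : plane] `|` [set (1, 0) : plane] `|` [set (0, 1) : plane])).
  move=> [x y] [hp [i hi]]; move: (hp 0) (hp 1) (hp 2%R) hi.
  rewrite /coords /=.
  case: i => [[|[|[|//]]] ?] /= h0 h1 h2 h; [left; left|left; right|right];
    by congr pair; lra.
by apply: negligibleU => //; apply: negligibleU.
Qed.

Lemma mean_eq (f g : plane -> R) :
  measurable_fun setT f -> measurable_fun setT g ->
  (forall p, standard_triangle p -> 0 <= f p) ->
  (forall p, standard_triangle p -> 0 <= g p) ->
  (forall p, standard_triangle p -> (forall i, coords p i < 1) -> f p = g p) ->
  mean (EFin \o f) = mean (EFin \o g).
Proof.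
move=> mf mg f0 g0 fg; congr (_ * _)%E.
have mT := @measurable_standard_triangle R.
apply: ge0_ae_eq_integral => //.
- by apply/measurable_EFinP/measurable_funTS.
- by apply/measurable_EFinP/measurable_funTS.
apply: (@negligibleS _ _ _ area _ _ _ negligible_vertices) => p /= h.
have [hp|nhp] := pselect (standard_triangle p); last by exfalso; apply: h.
split => //; apply: contrapT => /forallNP h1; apply: h => _.
rewrite fg // => i; rewrite ltNge; apply/negP; exact: h1.
Qed.

Lemma mean_le (f g : plane -> R) :
  measurable_fun setT f -> measurable_fun setT g ->
  (forall p, standard_triangle p -> 0 <= f p) ->
  (forall p, standard_triangle p -> 0 <= g p) ->
  (forall p, standard_triangle p -> (forall i, coords p i < 1) -> f p <= g p) ->
  (mean (EFin \o f) <= mean (EFin \o g))%E.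
Proof.
move=> mf mg f0 g0 fg.
(* The monotonicity of the integral is applied to an inequality valid on the whole triangle: h <= g
   holds everywhere, and h = f off the vertices. *)
pose h p := Num.min (f p) (g p).
have mh : measurable_fun [set: plane] h by exact: measurable_minr.
rewrite (@mean_eq f h) //.
- apply: lee_wpmul2l; first by rewrite inve_ge0; exact: measure_ge0.
  apply: ge0_le_integral => //.
  + exact: measurable_standard_triangle.
  + by move=> p hp; rewrite lee_fin le_min f0 // g0.
  + exact/measurable_EFinP/measurable_funTS.
  + exact/measurable_EFinP/measurable_funTS.
  + by move=> p hp; rewrite lee_fin ge_min lexx orbT.
- by move=> p hp; rewrite le_min f0 // g0.
- by move=> p hp hp1; rewrite /h min_l //; exact: fg.
Qed.

Lemma meanD (f g : plane -> R) :
  measurable_fun setT f -> measurable_fun setT g ->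
  (forall p, standard_triangle p -> 0 <= f p) ->
  (forall p, standard_triangle p -> 0 <= g p) ->
  (mean (EFin \o (fun p => f p + g p)%R) =
   mean (EFin \o f) + mean (EFin \o g))%E.
Proof.
move=> mf mg f0 g0; have mT := @measurable_standard_triangle R.
have pos (h : plane -> R) : (forall p, standard_triangle p -> 0 <= h p) ->
    (0 <= \int[area]_(p in standard_triangle) (h p)%:E)%E.
  by move=> h0; apply: integral_ge0 => p hp; rewrite lee_fin; exact: h0.
rewrite /mean -ge0_muleDr; [|exact: pos|exact: pos].
congr (_ * _)%E; rewrite -ge0_integralD //.
- exact/measurable_EFinP/measurable_funTS.
- exact/measurable_EFinP/measurable_funTS.
Qed.

Lemma meanZ (k : R) (f : plane -> R) :
  measurable_fun setT f -> (forall p, standard_triangle p -> 0 <= f p) ->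
  0 <= k -> (mean (EFin \o (fun p => k * f p)%R) = k%:E * mean (EFin \o f))%E.
Proof.
move=> mf f0 k0; have mT := @measurable_standard_triangle R.
rewrite /mean muleCA; congr (_ * _)%E; rewrite -ge0_integralZl //.
- exact/measurable_EFinP/measurable_funTS.
Qed.

Lemma mean_cst (k : R) : (mean (EFin \o cst k) = k%:E)%E.
Proof.
have mT := @measurable_standard_triangle R.
rewrite /mean.
have -> : (\int[area]_(p in standard_triangle) (EFin \o cst k) p
    = k%:E * area standard_triangle)%E.
  by rewrite -integral_cst.
rewrite muleCA.
have := @area_standard_triangle_gt0 R; have := @area_standard_triangle_lty R.
case: (area standard_triangle) => [s||] // _; rewrite lte_fin => s0.
by rewrite inver gt_eqF // -!EFinM mulVf ?gt_eqF // mulr1.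
Qed.

Lemma mean_ge0 (f : plane -> R) :
  (forall p, standard_triangle p -> 0 <= f p) -> (0 <= mean (EFin \o f))%E.
Proof.
move=> f0; apply: mule_ge0; first by rewrite inve_ge0; exact: measure_ge0.
by apply: integral_ge0 => p hp; rewrite lee_fin; exact: f0.
Qed.

(** * Pointwise identities behind (b), (c) and (d) *)

(** The bound on [a k] makes this true on the edges as well, where [x k = 0]: for exponent -1, 0^0 =
    1 would differ from 0^(-1) * 0 = 0. *)
Lemma prod_exprz_add (x : 'I_3 -> R) (a : multiindex) k :
  0 <= a k -> \prod_i x i ^ (a + vhat k) i = (\prod_i x i ^ a i) * x k.
Proof.
move=> ak; rewrite (bigD1 k) //= [in RHS](bigD1 k) //= mulrAC.
rewrite !ffunE eqxx; congr (_ * _).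
  by case: (a k) ak => // n _; rewrite -PoszD addn1 -exprSzr.
by apply: eq_bigr => i ik; rewrite !ffunE (negPf ik) addr0.
Qed.

Lemma prod_exprz_sub (x : 'I_3 -> R) (b : multiindex) k :
  x k != 0 -> \prod_i x i ^ (b - vhat k) i = (\prod_i x i ^ b i) / x k.
Proof.
move=> xk; rewrite (bigD1 k) //= [in RHS](bigD1 k) //= mulrAC.
rewrite !ffunE eqxx; congr (_ * _); first by rewrite expfzDr.
by apply: eq_bigr => i ik; rewrite !ffunE (negPf ik) subr0.
Qed.

Lemma integrand_add (a b : multiindex) k (p : plane) : 0 <= a k ->
  integrand (a + vhat k) b p = integrand a b p * coords p k.
Proof. by move=> ak; rewrite /integrand prod_exprz_add // mulrAC. Qed.

(** The base [1 - coords p k] is nonzero, so [b k] may be any integer, and the entry -1 that arises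
    from [b k = 0] is covered. *)
Lemma integrand_sub (a b : multiindex) k (p : plane) : coords p k < 1 ->
  integrand a (b - vhat k) p = integrand a b p * (1 - coords p k).
Proof.
move=> pk; rewrite /integrand prod_exprz_sub ?invf_div.
  by rewrite mulrA mulrAC.
by rewrite subr_eq0 gt_eqF.
Qed.

Lemma ord3_ind (P : 'I_3 -> Prop) : P 0 -> P 1 -> P 2%R -> forall i, P i.
Proof.
move=> P0 P1 P2 [[|[|[|//]]] lt_i3].
- by rewrite (_ : Ordinal lt_i3 = 0) //; exact: val_inj.
- by rewrite (_ : Ordinal lt_i3 = 1) //; exact: val_inj.
- by rewrite (_ : Ordinal lt_i3 = 2%R) //; exact: val_inj.
Qed.

Lemma sum3 (V : nmodType) (F : 'I_3 -> V) : \sum_i F i = F 0 + F 1 + F 2.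
Proof.
rewrite !big_ord_recl big_ord0 addr0 addrA.
by congr (_ + F _ + F _); exact: val_inj.
Qed.

Lemma prod3 (F : 'I_3 -> R) : \prod_i F i = F 0 * F 1 * F 2.
Proof.
rewrite !big_ord_recl big_ord0 mulr1 mulrA.
by congr (_ * F _ * F _); exact: val_inj.
Qed.

Lemma mean_integrandD a b a' b' :
  (mean (EFin \o integrand a b) + mean (EFin \o integrand a' b') =
   mean (EFin \o (fun p : plane => integrand a b p + integrand a' b' p)%R))%E.
Proof.
by rewrite meanD //; (exact: measurable_integrand || exact: integrand_ge0).
Qed.

(** The three numbers 1 - l_i add up to 2. *)
Lemma mean_lower_denominator (a b : multiindex) :
  mean (EFin \o integrand a b) =
  ((2^-1)%:E * (mean (EFin \o integrand a (b - vhat 0)) +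
                mean (EFin \o integrand a (b - vhat 1)) +
                mean (EFin \o integrand a (b - vhat 2))))%E.
Proof.
have mi := measurable_integrand; have i0 := integrand_ge0.
rewrite mean_integrandD -meanD //; last 3 first.
- by apply: measurable_funD; exact: mi.
- by move=> p hp; apply: addr_ge0; exact: i0.
- by move=> p hp; exact: i0.
rewrite -meanZ ?invr_ge0 //; last 2 first.
- by do 2?[apply: measurable_funD]; exact: mi.
- by move=> p hp; do 2?[apply: addr_ge0]; exact: i0.
apply: mean_eq => //.
- by apply: measurable_funM => //; do 2?[apply: measurable_funD]; exact: mi.
- by move=> p hp; exact: i0.
- by move=> p hp; rewrite mulr_ge0 ?invr_ge0 // !addr_ge0 //; exact: i0.
move=> p hp h; rewrite !integrand_sub //.
have := sum_coords p; rewrite sum3 => e.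
have -> : coords p 0 = 1 - coords p 1 - coords p 2 by lra.
by field.
Qed.

(** For (c), with [a] in the role of alpha - vhat 0 and k = 3 - j. *)
Lemma mean_split_numerator (a b : multiindex) (j k : 'I_3) :
  0 <= a 0 -> 0 <= a j ->
  (forall p : plane, coords p 0 + coords p j = 1 - coords p k) ->
  (mean (EFin \o integrand (a + vhat 0) b)
   + mean (EFin \o integrand (a + vhat j) b)
   = mean (EFin \o integrand a (b - vhat k)))%E.
Proof.
move=> a0 aj e; have mi := measurable_integrand; have i0 := integrand_ge0.
rewrite mean_integrandD; apply: mean_eq.
- by apply: measurable_funD; exact: mi.
- exact: mi.
- by move=> p hp; rewrite addr_ge0 //; exact: i0.
- by move=> p hp; exact: i0.
by move=> p hp h; rewrite integrand_sub // !integrand_add // -mulrDr e.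
Qed.

(** For (d), again with [a] in the role of alpha - vhat 0. The common factor is multiplied by the
    two sides of l_0 + l_1 l_2 = l_0 ((1 - l_1) + (1 - l_2)) / 2 + (l_1 (1 - l_1) + l_2 (1 - l_2)) /
    2, which follows from l_1 + l_2 = 1 - l_0. *)
Lemma mean_split_product (a b : multiindex) : (forall i, 0 <= a i) ->
  (mean (EFin \o integrand (a + vhat 0) b)
   + mean (EFin \o integrand (a + vhat 1 + vhat 2) b)
   = (2^-1)%:E * (mean (EFin \o integrand (a + vhat 0) (b - vhat 1)) +
                  mean (EFin \o integrand (a + vhat 0) (b - vhat 2)))
   + (2^-1)%:E * (mean (EFin \o integrand (a + vhat 1) (b - vhat 1)) +
                  mean (EFin \o integrand (a + vhat 2) (b - vhat 2))))%E.
Proof.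
move=> a0; have mi := measurable_integrand; have i0 := integrand_ge0.
have mD c d c' d' : measurable_fun [set: plane]
    (fun p : plane => integrand c d p + integrand c' d' p).
  by apply: measurable_funD; exact: mi.
have D0 c d c' d' (p : plane) : standard_triangle p ->
    0 <= integrand c d p + integrand c' d' p.
  by move=> hp; rewrite addr_ge0 //; exact: i0.
rewrite !mean_integrandD -!meanZ ?invr_ge0 //; try exact: D0.
rewrite -meanD; first last.
- by move=> p hp; rewrite mulr_ge0 ?invr_ge0 //; exact: D0.
- by move=> p hp; rewrite mulr_ge0 ?invr_ge0 //; exact: D0.
- by apply: measurable_funM.
- by apply: measurable_funM.
apply: mean_eq.
- exact: mD.
- by apply: measurable_funD; apply: measurable_funM.
- exact: D0.
- by move=> p hp; rewrite addr_ge0 // mulr_ge0 ?invr_ge0 //; exact: D0.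
move=> p hp h; rewrite !integrand_sub // !integrand_add //; last first.
  by rewrite !ffunE addr0.
have := sum_coords p; rewrite sum3 => e.
have -> : coords p 0 = 1 - coords p 1 - coords p 2 by lra.
by field.
Qed.

(** * Powers of the distance to a vertex, bounded by the integrand *)

Lemma measurable_power i m :
  measurable_fun [set: plane] (fun p : plane => (1 - coords p i) ^ m).
Proof.
apply: measurable_fun_exprz; apply: measurable_funB => //.
exact: measurable_coords.
Qed.

Lemma power_ge0 i m (p : plane) :
  standard_triangle p -> 0 <= (1 - coords p i) ^ m.
Proof.
by move=> hp; apply: exprz_ge0; rewrite subr_ge0; exact: standard_triangle_le1.
Qed.

(** On the triangle [1 - coords p 0] is comparable to the distance from vertex 0, so this is the
    model integral for a singularity at a vertex. *)
Definition mean_power (m : int) : \bar R :=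
  mean (EFin \o (fun p : plane => (1 - coords p 0) ^ m)).

Lemma triangle_mean_power (v : 'I_3 -> R * R) m : affinely_independent v ->
  ((area (triangle v))^-1 *
   \int[area]_(x in triangle v) ((1 - bary v 0 x) ^ m)%:E)%E = mean_power m.
Proof.
move=> hv; rewrite /mean_power -(triangle_mean hv); first last.
- by move=> p hp; rewrite lee_fin; exact: power_ge0.
- by apply/measurable_EFinP; exact: measurable_power.
by congr (_ * _)%E; apply: eq_integral => x _ /=; rewrite coords_bary_pair.
Qed.

Lemma affinely_independentP (v : 'I_3 -> R * R) :
  (forall l : 'I_3 -> R, \sum_i l i = 0 -> \sum_i l i * (v i).1 = 0 ->
     \sum_i l i * (v i).2 = 0 -> forall i, l i = 0) ->
  affinely_independent v.
Proof.
move=> h; apply: inj_row_free => l /rowP hl; apply/rowP => i; rewrite mxE.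
apply: (h (fun i => l 0 i)).
- have := hl 0; rewrite !mxE => e; rewrite -[RHS]e.
  by apply: eq_bigr => k _; rewrite !mxE mulr1.
- have := hl 1; rewrite !mxE => e; rewrite -[RHS]e.
  by apply: eq_bigr => k _; rewrite !mxE.
- have := hl 2%R; rewrite !mxE => e; rewrite -[RHS]e.
  by apply: eq_bigr => k _; rewrite !mxE.
Qed.

(** Exchanging the labels 0 and i keeps the triangle, hence the mean. *)
Lemma mean_power_eq i m :
  mean (EFin \o (fun p : plane => (1 - coords p i) ^ m)) = mean_power m.
Proof.
pose v (i : 'I_3) : R * R := [tuple (0, 0); (1, 0); (0, 1)]`_i.
have hv : affinely_independent v.
  apply: affinely_independentP => l; rewrite !sum3 /= => h0 h1 h2.
  by apply: ord3_ind; lra.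
pose s := tperm (0 : 'I_3) i.
have hs := affinely_independent_perm s hv.
rewrite -(triangle_mean_power m hv) -(triangle_mean hs); first last.
- by move=> p hp; rewrite lee_fin; exact: power_ge0.
- by apply/measurable_EFinP; exact: measurable_power.
rewrite triangle_perm //; congr (_ * _)%E; apply: eq_integral => x _ /=.
by rewrite coords_bary_pair // bary_perm // tpermR.
Qed.

Lemma mean_power_ge0_lty m : 0 <= m -> (mean_power m < +oo)%E.
Proof.
move=> m0; apply: (@le_lt_trans _ _ 1%E); last by rewrite ltry.
rewrite -(mean_cst 1); apply: mean_le => //.
- exact: measurable_power.
- by move=> p hp; exact: power_ge0.
move=> p hp _ /=; case: m m0 => // n _; apply: exprn_ile1.
  by rewrite subr_ge0; exact: standard_triangle_le1.
by rewrite gerBl; exact: hp.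
Qed.


Lemma mean_lty_integral (f : plane -> R) :
  (mean (EFin \o f) < +oo ->
   \int[area]_(p in standard_triangle) (f p)%:E < +oo)%E.
Proof.
rewrite /mean.
have := @area_standard_triangle_gt0 R; have := @area_standard_triangle_lty R.
case: (area standard_triangle) => [s||] // _; rewrite lte_fin => s0.
rewrite inver gt_eqF //; set I := integral _ _ _ => h.
have -> : I = (s%:E * ((s^-1)%:E * I))%E.
  by rewrite muleA -EFinM mulfV ?gt_eqF // mul1e.
case: (_ * I)%E h => [r||] // _; first by rewrite -EFinM ltry.
by rewrite gt0_muleNy ?lte_fin.
Qed.

(* On the subtriangle with vertices (0, 0), (3/8, 1/8), (1/8, 3/8) the
   coordinates 1 and 2 are at least 1/8 of the distance 1 - lambda_0 to the
   vertex, so there the integrand is comparable to a power of that distance. *)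
Lemma mean_power_lty_of_integrand a b : nonneg_mi a -> nonneg_mi b ->
  mi_size a - a 0 - b 0 < 0 ->
  (mean (EFin \o integrand a b) < +oo)%E ->
  (mean_power (mi_size a - a 0 - b 0)%R < +oo)%E.
Proof.
move=> ha hb; set m := mi_size a - a 0 - b 0 => m0 hfin.
pose w (i : 'I_3) : R * R := [tuple (0, 0); (3/8, 1/8); (1/8, 3/8)]`_i.
have hw : affinely_independent w.
  apply: affinely_independentP => l; rewrite !sum3 /= => h0 h1 h2.
  by apply: ord3_ind; lra.
have wE x : [/\ bary w 0 x + bary w 1 x + bary w 2%R x = 1,
    x.1 = 3/8 * bary w 1 x + 1/8 * bary w 2%R x &
    x.2 = 1/8 * bary w 1 x + 3/8 * bary w 2%R x].
  have [] := (baryP x (fun i => bary w i x) hw).2 (fun=> erefl).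
  by rewrite !sum3 /= => h0 h1 h2; split; lra.
(* On [triangle w], 8 times coordinate 1 or 2 is at least [1 - bary w 0 x], and 8 times coordinate 0
   is at least 1; C collects these factors 8. *)
pose C := \prod_i (8 : R) ^ a i.
have C0 : 0 <= C by apply: prodr_ge0 => i _; exact: exprz_ge0.
have sub x : triangle w x -> standard_triangle x.
  rewrite triangleE // => hx; have [] := wE x; move: (hx 0) (hx 1) (hx 2%R).
  by move=> ? ? ? ? ? ?; case=> [[|[|[|//]]] ?]; rewrite /coords /=; lra.
have bound x : triangle w x -> (1 - bary w 0 x) ^ m <= C * integrand a b x.
  move=> Tx; have sx := sub x Tx; move: Tx; rewrite triangleE // => hx.
  have [] := wE x; move: (hx 0) (hx 1) (hx 2%R).
  set t0 := bary w 0 x; set t1 := bary w 1 x; set t2 := bary w 2%R x.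
  move=> p0 p1 p2 e e1 e2.
  (* At the common vertex the left side is 0^m, which is 0 by convention as m is negative. *)
  have [t0E|t0N1] := eqVneq t0 1.
    by rewrite t0E subrr exp0rz (lt_eqF m0) mulr_ge0 // integrand_ge0.
  have t01 : 0 < 1 - t0.
    by rewrite subr_gt0 lt_neqAle t0N1 /=; lra.
  rewrite /integrand /C !prod3 /coords /= e1 e2 -/t1 -/t2.
  have -> : m = a 1 + a 2%R - b 0 by rewrite /m /mi_size sum3; ring.
  have := ha 0; have := ha 1; have := ha 2%R.
  have := hb 0; have := hb 1; have := hb 2%R.
  case: (a 0) => // n0; case: (a 1) => // n1; case: (a 2%R) => // n2.
  case: (b 0) => // k0; case: (b 1) => // k1; case: (b 2%R) => // k2.
  move=> _ _ _ _ _ _.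
  rewrite !expfzDr ?lt0r_neq0 // -invr_expz.
  set c1 := 3 / 8 * t1 + 1 / 8 * t2; set c2 := 1 / 8 * t1 + 3 / 8 * t2.
  have c0E : 1 - (1 - c1 - c2) = (1 - t0) / 2 by rewrite /c1 /c2; lra.
  have c18 : 1 - t0 <= 8 * c1 by rewrite /c1; lra.
  have c28 : 1 - t0 <= 8 * c2 by rewrite /c2; lra.
  have c08 : 1 <= 8 * (1 - c1 - c2) by rewrite /c1 /c2; lra.
  have c11 : 0 < 1 - c1 <= 1 by rewrite /c1; apply/andP; split; lra.
  have c21 : 0 < 1 - c2 <= 1 by rewrite /c2; apply/andP; split; lra.
  have {c0E} c00 : 0 < 1 - (1 - c1 - c2) <= 1 - t0 by apply/andP; split; lra.
  move: c1 c2 (1 - t0) (1 - c1 - c2) t01 c18 c28 c08 c11 c21 c00.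
  move=> c1 c2 t c0 tp h1 h2 h0 /andP[d1 d1'] /andP[d2 d2'] /andP[d0 d0'].
  rewrite -!exprnP mulrA.
  have -> : 8 ^+ n0 * 8 ^+ n1 * 8 ^+ n2 * (c0 ^+ n0 * c1 ^+ n1 * c2 ^+ n2)
    = (8 * c0) ^+ n0 * (8 * c1) ^+ n1 * (8 * c2) ^+ n2.
    by rewrite !exprMn; ring.
  apply: ler_pM; rewrite ?invr_ge0 ?mulr_ge0 ?exprn_ge0 ?(ltW tp) //.
    apply: ler_pM; rewrite ?exprn_ge0 ?(ltW tp) //.
      rewrite -[leLHS]mul1r; apply: ler_pM; rewrite ?exprn_ge0 ?(ltW tp) //.
        exact: exprn_ege1.
      by apply: lerXn2r; rewrite // nnegrE; lra.
    by apply: lerXn2r; rewrite // nnegrE; lra.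
  (* In the denominator [1 - c0] is at most t and the other two bases are at most 1. *)
  rewrite lef_pV2 ?posrE ?mulr_gt0 ?exprn_gt0 //.
  rewrite -mulrA -[leRHS]mulr1; apply: ler_pM; rewrite ?mulr_ge0 ?exprn_ge0
    ?(ltW d0) ?(ltW d1) ?(ltW d2) //.
    by apply: lerXn2r; rewrite // nnegrE; lra.
  by apply: mulr_ile1; rewrite ?exprn_ge0 ?exprn_ile1 ?(ltW d1) ?(ltW d2).
rewrite -(triangle_mean_power m hw).
have mT : measurable (triangle w : set plane) := measurable_triangle hw.
apply: (@le_lt_trans _ _ ((area (triangle w))^-1 *
    (C%:E * \int[area]_(x in standard_triangle) (integrand a b x)%:E)))%E.
  apply: lee_wpmul2l; first by rewrite inve_ge0; exact: measure_ge0.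
  have mS := @measurable_standard_triangle R.
  have -> : (C%:E * \int[area]_(x in standard_triangle) (integrand a b x)%:E
    = \int[area]_(x in standard_triangle) (C%:E * (integrand a b x)%:E))%E.
    rewrite ge0_integralZl //.
    - by apply/measurable_EFinP/measurable_funTS; exact: measurable_integrand.
    - by move=> x hx; rewrite lee_fin; exact: integrand_ge0.
  apply: (@le_trans _ _
    (\int[area]_(x in triangle w) (C%:E * (integrand a b x)%:E)))%E.
    apply: (@ge0_le_integral _ _ _ area _ mT
      (fun x => ((1 - bary w 0 x) ^ m)%:E)).
    - move=> x; rewrite triangleE // => hx; rewrite lee_fin exprz_ge0 //.
      by have [h _ _] := wE x; move: (hx 0) (hx 1) (hx 2%R); lra.
    - apply/measurable_EFinP/measurable_funTS/measurable_fun_exprz.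
      by apply: measurable_funB => //; exact: measurable_bary.
    - apply/measurable_EFinP/measurable_funTS/measurable_funM => //.
      exact: measurable_integrand.
    - by move=> x /bound; rewrite -EFinM lee_fin.
  apply: ge0_subset_integral => //.
  - apply/measurable_EFinP/measurable_funTS/measurable_funM => //.
    exact: measurable_integrand.
  - by move=> x hx; rewrite -EFinM lee_fin mulr_ge0 // integrand_ge0.
have I0 : (0 <= \int[area]_(x in standard_triangle) (integrand a b x)%:E)%E.
  by apply: integral_ge0 => x hx; rewrite lee_fin integrand_ge0.
move: I0 (mean_lty_integral hfin).
case: (\int[area]_(x in _) _)%E => [r||] // _ _.
have := area_triangle_gt0 hw; have := area_triangle_lty hw.
case: (area (triangle w)) => [s||] // _; rewrite lte_fin => s0.
by rewrite inver gt_eqF // -!EFinM ltry.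
Qed.

(** * The integrand bounded by powers of the distances to the vertices *)

Lemma prod_exprz_sum (t : R) (P : pred 'I_3) (n : 'I_3 -> int) : t != 0 ->
  \prod_(i | P i) t ^ n i = t ^ (\sum_(i | P i) n i).
Proof.
move=> t0; have mor : {morph (fun m : int => t ^ m) : x y / x + y >-> x * y}.
  by move=> x y /=; rewrite expfzDr.
exact/esym/(big_morph _ mor).
Qed.

(** Two coordinates cannot both exceed 1/2, because all three are nonnegative with sum 1. *)
Lemma exists_dominant_coord (p : plane) : standard_triangle p ->
  exists i, forall k, k != i -> coords p k <= 1 / 2.
Proof.
move=> hp; have := sum_coords p; rewrite sum3 => e.
have := hp 0; have := hp 1; have := hp 2%R => h2 h1 h0.
have h (k : 'I_3) : k = 0 \/ k = 1 \/ k = 2%R.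
  by move: k; apply: ord3_ind; [left|right; left|right; right].
have [l0|l0] := lerP (coords p 0) (1 / 2); last first.
  exists 0 => k; have [->|[->|->]] := h k; rewrite ?eqxx // => _; lra.
have [l1|l1] := lerP (coords p 1) (1 / 2); last first.
  exists 1 => k; have [->|[->|->]] := h k; rewrite ?eqxx // => _; lra.
by exists 2%R => k; have [->|[->|->]] := h k; rewrite ?eqxx.
Qed.

(* At a point where coordinate i dominates, all the other factors of the
   denominator are bounded below. *)
Lemma integrand_le_power a b (p : plane) : nonneg_mi a -> nonneg_mi b ->
  standard_triangle p -> (forall i, coords p i < 1) ->
  exists i, integrand a b p <=
    (\prod_i 2 ^ b i) * (1 - coords p i) ^ (mi_size a - a i - b i).
Proof.
move=> ha hb hp lt1; have [i hi] := exists_dominant_coord hp; exists i.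
set t := 1 - coords p i; have t0 : 0 < t by rewrite subr_gt0.
have -> : mi_size a - a i - b i = \sum_(k | k != i) a k + - b i.
  by rewrite /mi_size (bigD1 i) //= (addrC (a i)) addrK.
rewrite expfzDr ?gt_eqF // -invr_expz -prod_exprz_sum ?gt_eqF //.
(* The comparison is made factor by factor. For k other than i, l_k <= t and 1 / (1 - l_k) <= 2; for
   k = i the numerator is at most 1, hence at most 2 ^ b i. *)
rewrite /integrand -prodf_div (bigD1 i) //= [in leRHS](bigD1 i) //=.
rewrite [X in _ <= _ * X]mulrC mulrACA -big_split /= -/t.
have le_t k : k != i -> coords p k <= t.
  move=> ki; rewrite /t -(sum_coords p) (bigD1 i) //= addrC addrK.
  by rewrite (bigD1 k) //= lerDl; apply: sumr_ge0 => h _; exact: hp.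
apply: ler_pM.
- by apply: divr_ge0; apply: exprz_ge0; [exact: hp|exact: ltW].
- apply: prodr_ge0 => k _; apply: divr_ge0; apply: exprz_ge0; first exact: hp.
  by rewrite subr_ge0 ltW.
- apply: ler_wpM2r; first by rewrite invr_ge0 exprz_ge0 // ltW.
  apply: (@le_trans _ _ 1).
    case: (a i) (ha i) => // n _; apply: exprn_ile1; first exact: hp.
    exact: ltW.
  by case: (b i) (hb i) => // n _; apply: exprn_ege1; lra.
apply: ler_prod => k ki; have lk := hi k ki.
apply/andP; split.
  by rewrite divr_ge0 // exprz_ge0 ?subr_ge0 ?(ltW (lt1 k)) //; exact: hp.
rewrite mulrC; apply: ler_pM.
- by rewrite invr_ge0 exprz_ge0 // subr_ge0 ltW.
- by rewrite exprz_ge0 //; exact: hp.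
- case: (b k) (hb k) => // n _; rewrite -!exprnP -exprVn.
  have h : (1 - coords p k)^-1 <= 2.
    by rewrite invf_ple ?posrE ?subr_gt0 //; lra.
  by apply: lerXn2r => //; rewrite nnegrE // invr_ge0 subr_ge0 ltW.
- case: (a k) (ha k) => // n _; apply: lerXn2r; rewrite ?nnegrE ?(ltW t0) //.
  exact: le_t.
Qed.

(** The dominant index varies with the point, so the integrand is bounded by a multiple of the sum
    of all three powers. *)
Lemma mean_integrand_lty a b : nonneg_mi a -> nonneg_mi b ->
  (forall i, mean_power (mi_size a - a i - b i)%R < +oo)%E ->
  (mean (EFin \o integrand a b) < +oo)%E.
Proof.
move=> ha hb hfin; pose m i := mi_size a - a i - b i.
pose C := \prod_i (2 : R) ^ b i.
have C0 : 0 <= C by apply: prodr_ge0 => i _; exact: exprz_ge0.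
pose f i (p : plane) := (1 - coords p i) ^ m i.
have mf i : measurable_fun [set: plane] (f i) := measurable_power i (m i).
have f0 i (p : plane) : standard_triangle p -> 0 <= f i p
  := @power_ge0 i (m i) p.
have fS p : standard_triangle p -> 0 <= f 0 p + f 1 p + f 2%R p.
  by move=> hp; rewrite !addr_ge0 // f0.
have mS : measurable_fun [set: plane] (fun p => f 0 p + f 1 p + f 2%R p).
  by do 2?[apply: measurable_funD]; exact: mf.
apply: (@le_lt_trans _ _
    (mean (EFin \o (fun p => C * (f 0 p + f 1 p + f 2%R p))%R))).
  apply: mean_le.
  - exact: measurable_integrand.
  - exact: measurable_funM.
  - by move=> p hp; exact: integrand_ge0.
  - by move=> p hp; rewrite mulr_ge0 // fS.
  move=> p hp lt1; have [i hi] := integrand_le_power ha hb hp lt1.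
  apply: (le_trans hi); apply: ler_wpM2l => //; rewrite -/(m i) -/(f i p).
  rewrite -(sum3 (fun k => f k p)) (bigD1 i) //= lerDl.
  apply: sumr_ge0 => k _; exact: f0.
rewrite meanZ // (@meanD (fun p => f 0 p + f 1 p)) //.
- rewrite meanD //; try exact: f0.
  rewrite !mean_power_eq; apply: lte_mul_pinfty => //.
  by do 2?[apply: lte_add_pinfty]; exact: hfin.
- by apply: measurable_funD; exact: mf.
- by move=> p hp; rewrite addr_ge0 // f0.
- exact: f0.
Qed.

(** * Finiteness at the borderline exponent -1 *)

(** On the triangle (0,0), (1,0), (1,1) the integrand is 1/x, and the section at abscissa x is
    [0, x], whose length cancels it. The iterated integral is at most that of 1 over [0, 1]. *)
Lemma mean_powerN1_lty : (mean_power (-1)%R < +oo)%E.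
Proof.
pose z (i : 'I_3) : R * R := [tuple (0, 0); (1, 0); (1, 1)]`_i.
have hz : affinely_independent z.
  apply: affinely_independentP => l; rewrite !sum3 /= => h0 h1 h2.
  by apply: ord3_ind; lra.
have zE x : [/\ bary z 0 x + bary z 1 x + bary z 2%R x = 1,
    x.1 = bary z 1 x + bary z 2%R x & x.2 = bary z 2%R x].
  have [] := (baryP x (fun i => bary z i x) hz).2 (fun=> erefl).
  by rewrite !sum3 /= => h0 h1 h2; split; lra.
have mT : measurable (triangle z : set plane) := measurable_triangle hz.
rewrite -(triangle_mean_power _ hz).
suff : (\int[area]_(x in triangle z) ((1 - bary z 0 x) ^ (-1))%:E <= 1)%E.
  have : (0 <= \int[area]_(x in triangle z) ((1 - bary z 0 x) ^ (-1))%:E)%E.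
    apply: integral_ge0 => x; rewrite triangleE // => hx.
    rewrite lee_fin invr_ge0 subr_ge0; have [] := zE x.
    by move: (hx 1) (hx 2%R); lra.
  case: (\int[area]_(x in _) _)%E => [r||] // _ _.
  have := area_triangle_gt0 hz; have := area_triangle_lty hz.
  case: (area (triangle z)) => [s||] // _; rewrite lte_fin => s0.
  by rewrite inver gt_eqF // -!EFinM ltry.
rewrite integral_mkcond.
set F := (X in integral _ _ X).
have F0 x : (0 <= F x)%E.
  rewrite /F patchE; case: ifPn => // /[!inE]; rewrite triangleE // => hx.
  rewrite lee_fin invr_ge0 subr_ge0; have [] := zE x.
  by move: (hx 1) (hx 2%R); lra.
have mF : measurable_fun [set: plane] F.
  apply/(measurable_restrictT _ mT)/measurable_EFinP/measurable_funTS.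
  apply: measurable_fun_exprz.
  by apply: measurable_funB => //; exact: measurable_bary.
rewrite (fubini_tonelli1 (m1 := lebesgue1) (m2 := lebesgue1)) //.
pose c (x : R) : R := \1_(`[0, 1] : set line) x * x^-1.
have c0 x : 0 <= c x.
  rewrite /c indicE; have [xI|_] := boolP (x \in _); last by rewrite mul0r.
  by move: xI; rewrite inE /= in_itv /= mul1r invr_ge0 => /andP[].
have Fle (x y : R) : (F (x, y) <= (c x)%:E * (\1_(`[0, x] : set line) y)%:E)%E.
  rewrite /F patchE; case: ifPn => [/[!inE]|_]; last first.
    by rewrite -EFinM lee_fin mulr_ge0 // indicE.
  rewrite triangleE // => hx; have [e1 /= e2 e3] := zE (x, y).
  have h0 := hx 0; have h1 := hx 1; have h2 := hx 2%R.
  rewrite -EFinM lee_fin /c !indicE !mem_set /=; last 2 first.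
  - by rewrite in_itv /=; apply/andP; split; lra.
  - by rewrite in_itv /=; apply/andP; split; lra.
  by rewrite mul1r mulr1 (_ : 1 - bary z 0 (x, y) = x) //; lra.
have mitv (x : R) : measurable (`[0, x] : set line) by exact: measurable_itv.
have inner (x : line) :
    (fubini_F lebesgue1 F x <= (\1_(`[0, 1] : set line) x)%:E)%E.
  rewrite /fubini_F.
  apply: (@le_trans _ _
    (\int[lebesgue1]_y ((c x)%:E * (\1_(`[0, x] : set line) y)%:E))%E).
    apply: ge0_le_integral => //.
    - by apply: (measurableT_comp mF); exact: pair1_measurable.
    - apply/measurable_EFinP/measurable_funM => //.
  rewrite ge0_integralZl //; last 2 first.
  - by apply/measurable_EFinP; exact: measurable_indic.
  - by rewrite lee_fin.
  rewrite integral_indic // setIT /c /= lebesgue_measure_itv /= indicE.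
  have [xI|_] := boolP (x \in _); last by rewrite mul0r mul0e.
  rewrite mul1r; case: ifPn => [|_]; last by rewrite mule0 lee_fin.
  rewrite lte_fin => x0; rewrite -EFinB -EFinM subr0 mulVf ?lee_fin //.
  by rewrite gt_eqF.
apply: (@le_trans _ _ (\int[lebesgue1]_x (\1_(`[0, 1] : set line) x)%:E)%E).
  apply: ge0_le_integral => //.
  - by move=> x _; apply: integral_ge0.
  - exact: measurable_fun_fubini_tonelli_F.
  - by apply/measurable_EFinP; exact: measurable_indic.
rewrite integral_indic // setIT /= lebesgue_measure_itv /= lte_fin ltr01.
by rewrite -EFinB subr0.
Qed.

(** The threshold reflects the dimension: r^m * r is integrable at 0 exactly for m > -2, and m is an
    integer. *)
Lemma mean_power_lty m : -1 <= m -> (mean_power m < +oo)%E.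
Proof.
rewrite le_eqVlt => /predU1P[<-|m1]; first exact: mean_powerN1_lty.
by apply: mean_power_ge0_lty; lia.
Qed.

(** * Finiteness of the terms to be subtracted *)

Lemma mi_size_perm (s : 'S_3) a : mi_size (mi_perm s a) = mi_size a.
Proof.
rewrite /mi_size [RHS](reindex_inj (@perm_inj _ s)).
by apply: eq_bigr => i _; rewrite ffunE.
Qed.

Lemma mi_sizeD (a b : multiindex) : mi_size (a + b) = mi_size a + mi_size b.
Proof.
by rewrite /mi_size -big_split; apply: eq_bigr => i _; rewrite ffunE.
Qed.

Lemma mi_size_vhat k : mi_size (vhat k) = 1.
Proof.
rewrite /mi_size (bigD1 k) //= ffunE eqxx big1 ?addr0 // => i ik.
by rewrite ffunE (negPf ik).
Qed.

(** For exponents below -1 a transposition brings vertex i to position 0, where the lower bound on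
    the integrand passes finiteness on to the power. *)
Lemma mean_power_lty_of_Iint v a b i : affinely_independent v ->
  nonneg_mi a -> nonneg_mi b -> (@Iint R v a b < +oo)%E ->
  (mean_power (mi_size a - a i - b i)%R < +oo)%E.
Proof.
move=> hv ha hb hfin; have [m|m] := lerP (-1) (mi_size a - a i - b i).
  exact: mean_power_lty.
pose s := tperm (0 : 'I_3) i.
have e : mi_size (mi_perm s a) - mi_perm s a 0 - mi_perm s b 0
       = mi_size a - a i - b i by rewrite mi_size_perm !ffunE tpermL.
rewrite -e; apply: mean_power_lty_of_integrand.
- by move=> k; rewrite ffunE; exact: ha.
- by move=> k; rewrite ffunE; exact: hb.
- by rewrite e (lt_trans m).
- by rewrite -(Iint_mean _ _ hv) Iint_perm.
Qed.

Lemma Iint_lty_numerator v a a' b : affinely_independent v ->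
  nonneg_mi a -> nonneg_mi a' -> nonneg_mi b -> (@Iint R v a b < +oo)%E ->
  (forall i, -1 <= mi_size a' - a' i - b i \/
     mi_size a' - a' i = mi_size a - a i) ->
  (Iint v a' b < +oo)%E.
Proof.
move=> hv ha ha' hb hfin h; rewrite (Iint_mean _ _ hv).
apply: (mean_integrand_lty ha' hb) => i.
have [hi|->] := h i; first exact: (mean_power_lty hi).
exact: (mean_power_lty_of_Iint i hv ha hb hfin).
Qed.

Lemma Iint_ge0 v a b : affinely_independent v -> (0 <= @Iint R v a b)%E.
Proof.
by move=> hv; rewrite Iint_mean //; apply: mean_ge0 => p; exact: integrand_ge0.
Qed.

End Integrand.

Theorem proposition3p9 (R : realType) (v : 'I_3 -> R * R)
    (hv : affinely_independent v) (a b : multiindex)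
    (ha : nonneg_mi a) (hb : nonneg_mi b) (hfin : (Iint v a b < +oo)%E) :
  [/\ forall s : 'S_3, Iint v a b = Iint v (mi_perm s a) (mi_perm s b),
      (forall i, 1 <= b i) ->
        Iint v a b =
          ((2^-1)%:E * (Iint v a (b - vhat 0) + Iint v a (b - vhat 1)
                        + Iint v a (b - vhat 2)))%E,
      b 0 = 0 -> 1 <= a 0 ->
        forall j : 'I_3, j = 1 \/ j = 2 -> a j + b j < mi_size a + 1 ->
          Iint v a b =
            (Iint v (a - vhat 0) (b - vhat (inord (3 - j)%N))
             - Iint v (a - vhat 0 + vhat j) b)%E
    & b 0 = 0 -> 1 <= b 1 -> 1 <= b 2 -> 0 < a 0 ->
        Iint v a b =
          ((2^-1)%:E * (Iint v a (b - vhat 1) + Iint v a (b - vhat 2))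
           - Iint v (a - vhat 0 + vhat 1 + vhat 2) b
           + (2^-1)%:E * (Iint v (a - vhat 0 + vhat 1) (b - vhat 1)
                          + Iint v (a - vhat 0 + vhat 2) (b - vhat 2)))%E].
Proof.
have lowered (k : 'I_3) : 1 <= a k -> nonneg_mi (a - vhat k).
  move=> ak i; rewrite !ffunE; case: eqP => [->|_]; last by rewrite subr0.
  by rewrite subr_ge0.
have vhat_ge0 k : nonneg_mi (vhat k) by move=> i; rewrite ffunE.
have add_ge0 c d : nonneg_mi c -> nonneg_mi d -> nonneg_mi (c + d).
  by move=> hc hd i; rewrite ffunE addr_ge0.
have ord3 (k : 'I_3) : [\/ k = 0, k = 1 | k = 2%R].
  by move: k; apply: ord3_ind; [constructor 1|constructor 2|constructor 3].
have sizeN (c : multiindex) k : mi_size (c - vhat k) = mi_size c - 1.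
  have := mi_sizeD (c - vhat k) (vhat k).
  by rewrite subrK mi_size_vhat => ->; rewrite addrK.
have size3 : mi_size a = a 0 + a 1 + a 2%R by rewrite /mi_size sum3.
split.
- by move=> s; rewrite Iint_perm.
- by move=> _; rewrite !Iint_mean //; exact: mean_lower_denominator.
- move=> b0 a0 j hj hlt; set c := a - vhat 0.
  have cE : a = c + vhat 0 by rewrite /c subrK.
  have hc : nonneg_mi c by exact: lowered.
  have fin : (Iint v (c + vhat j) b < +oo)%E.
    apply: (Iint_lty_numerator hv ha _ hb hfin); first exact: add_ge0.
    (* The size is unchanged. The exponent at vertex 0 is nonnegative because [b 0 = 0]; at j it
       drops by 1, and [hlt] keeps it at least -1; at 3 - j it stays the same. *)
    move=> i; rewrite mi_sizeD mi_size_vhat /c sizeN subrK !ffunE.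
    case: hj hlt => ->; case: (ord3 i) => ->; rewrite /= ?b0 size3 => hlt;
      move: (ha 1) (ha 2%R); lia.
  have e p : @coords R p 0 + coords p j = 1 - coords p (inord (3 - j)).
    have := sum_coords p; rewrite sum3.
    have -> : inord (3 - j) = (if j == 1 then 2 else 1) :> 'I_3.
      by case: hj => ->; apply: val_inj; rewrite /= inordK.
    by case: hj => ->; rewrite /=; lra.
  have := mean_split_numerator b (hc 0) (hc j) e.
  rewrite -cE -!(Iint_mean _ _ hv) => <-.
  by rewrite addeK // ge0_fin_numE // Iint_ge0.
- move=> b0 _ _ a0; set c := a - vhat 0.
  have cE : a = c + vhat 0 by rewrite /c subrK.
  have hc : nonneg_mi c by exact: lowered.
  have fin : (Iint v (c + vhat 1 + vhat 2) b < +oo)%E.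
    apply: (Iint_lty_numerator hv ha _ hb hfin); first
      exact: add_ge0 (add_ge0 _ _ hc (vhat_ge0 _)) (vhat_ge0 _).
    (* The size and the entries 1 and 2 all grow by 1, so the exponents at vertices 1 and 2 are
       those of a; at vertex 0 the exponent is positive because [b 0 = 0]. *)
    move=> i; rewrite mi_sizeD mi_sizeD !mi_size_vhat /c sizeN subrK !ffunE.
    case: (ord3 i) => ->; rewrite /= ?b0 size3; move: (ha 1) (ha 2%R); lia.
  have := @mean_split_product R _ b hc.
  rewrite -cE -!(Iint_mean _ _ hv) => e.
  rewrite -[LHS](@addeK _ (Iint v (c + vhat 1 + vhat 2) b)) ?e.
    by rewrite addeAC.
  by rewrite ge0_fin_numE // Iint_ge0.
Qed.
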